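(* Let $g$ be a probability kernel on a countable alphabet $A$ such that $\inf_{a\in A,\,x\in\mathcal{X}^-}g(a|x)>0$ and $\lim_{j\to\infty}\mathrm{Var}_j(g)=0$. If $g$ has two (or more) distinct ergodic compatible measures, then they do not satisfy a Gaussian concentration bound (GCB); that is, none of the ergodic measures compatible with $g$ satisfies GCB.
   Context: $A$ is a countable set with the discrete topology; $A^{\mathbb{Z}}$ has the product topology and the $\sigma$-algebra generated by cylinders; ergodic means shift-invariant and ergodic for the shift $(T\omega)_i=\omega_{i+1}$. For integers $i\le j$, $\omega_i^j=(\omega_i,\dots,\omega_j)$ (the empty string if $i>j$). $\mathcal{X}^-=A^{\{\dots,-2,-1\}}$. A probability kernel is a function $g:A\times\mathcal{X}^-\to[0,1]$ with $\sum_{s\in A}g(s|x)=1$ for all $x\in\mathcal{X}^-$; for a left-infinite sequence ending at another index $n-1$, $g(\cdot|\cdot)$ denotes the same function after re-indexing (kernels are shift-invariant). A probability measure $\mu$ on $A^{\mathbb{Z}}$ is compatible with $g$ if for all $n\in\mathbb{Z}$, $a\in A$, and $\mu$-a.e. past $x=(\dots,x_{n-2},x_{n-1})$, the conditional probability under $\mu$ that the $n$-th coordinate equals $a$ given the $\sigma$-algebra generated by coordinates up to $n-1$ is $g(a|x)$. For $j\ge1$, $\mathrm{Var}_j(g)=\sup\{\frac12\sum_{a\in A}|g(a|z)-g(a|z')|: z,z'\in\mathcal{X}^-,\ z_k=z'_k\ \forall k\ge -j\}$. For $f:A^{n+1}\to\mathbb{R}$ and $0\le j\le n$, $\delta_j(f)=\sup\{|f(\omega_0^{j-1}a\,\omega_{j+1}^n)-f(\omega_0^{j-1}b\,\omega_{j+1}^n)|: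 a,b\in A,\ \omega\in A^{n+1}\}$. $\mathcal{L}=\bigcup_{n\ge0}\mathcal{L}_n$ with $\mathcal{L}_n=\{f:A^{n+1}\to\mathbb{R}: \delta_j(f)<\infty,\ j=0,\dots,n\}$; such $f$ is viewed as a function of coordinates $0,\dots,n$. $\|\underline{\delta}(f)\|_2^2=\sum_{j=0}^n\delta_j(f)^2$ for $f\in\mathcal{L}_n$. A probability measure $\mu$ satisfies a Gaussian concentration bound (GCB) if there is a constant $C>0$ such that for all $f\in\mathcal{L}$, $\mathbb{E}_\mu[e^{f-\mathbb{E}_\mu[f]}]\le e^{C\|\underline{\delta}(f)\|_2^2}$ ($C$ independent of $f$ and $n$). *)

(* Defs.v *)
From HB Require Import structures.
From mathcomp Require Import all_boot all_order all_algebra.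
From mathcomp Require Import all_classical all_reals all_analysis.

Set Implicit Arguments.
Unset Strict Implicit.
Unset Printing Implicit Defensive.

Import Order.TTheory GRing.Theory Num.Theory.
Import numFieldNormedType.Exports.

Local Open Scope classical_set_scope.
Local Open Scope ring_scope.

Definition cylinder (A : Type) (i j : int) (c : int -> A) : set (int -> A) :=
  [set w | forall k : int, i <= k <= j -> w k = c k].

Definition cylinders (A : Type) : set (set (int -> A)) :=
  [set B | exists i j c, B = cylinder i j c].

(* A^Z.  Measurable types of the library are pointed, hence [A : pointedType];
   a probability measure on A^Z exists only if A is inhabited anyway. *)
Notation fullshift A := (g_sigma_algebraType (@cylinders A)).

Definition shiftZ (A : Type) (w : int -> A) : int -> A := fun i => w (i + 1).

(* An element x of A^{..., -2, -1} is encoded as a function on nat: [x k] is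
   the coordinate of index -(k+1). *)
Definition left_seq (A : Type) := nat -> A.

(* (..., w_{n-2}, w_{n-1}), re-indexed so as to end at index -1. *)
Definition past (A : Type) (n : int) (w : int -> A) : left_seq A :=
  fun k => w (n - k.+1%:Z).

(* The sigma-algebra generated by the coordinates up to n - 1 (every subset D
   of the discrete alphabet being measurable). *)
Definition past_sigma_algebra (A : Type) (n : int) : set (set (int -> A)) :=
  <<s [set B | exists (k : int) (D : set A),
         k <= n - 1 /\ B = [set w | D (w k)] ] >>.

Definition is_prob_kernel (R : realType) (A : pointedType)
    (g : A -> left_seq A -> R) : Prop :=
  (forall a x, 0 <= g a x <= 1) /\
  (forall x, \esum_(a in [set: A]) (g a x)%:E = 1%E).

(* [z] and [z'] agree on the coordinates -1, ..., -j. *)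
Definition kernel_var (R : realType) (A : pointedType)
    (g : A -> left_seq A -> R) (j : nat) : \bar R :=
  ereal_sup [set v | exists z z' : left_seq A,
    (forall k, (k < j)%N -> z k = z' k) /\
    v = ((2^-1)%:E * \esum_(a in [set: A]) `|g a z - g a z'|%:E)%E].

(* [h] is a version of the conditional probability of E given the
   sub-sigma-algebra G. *)
Definition cond_prob_version d (T : measurableType d) (R : realType)
    (P : probability T R) (G : set (set T)) (E : set T) (h : T -> R) : Prop :=
  [/\ forall Y : set R, measurable Y -> G (h @^-1` Y),
      P.-integrable [set: T] (EFin \o h) &
      forall B, G B -> (\int[P]_(w in B) (h w)%:E = P (E `&` B))%E].

Definition compatible (R : realType) (A : pointedType)
    (g : A -> left_seq A -> R) (mu : probability (fullshift A) R) : Prop :=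
  forall (n : int) (a : A),
    exists2 h : fullshift A -> R,
      cond_prob_version mu (past_sigma_algebra n) [set w | w n = a] h &
      {ae mu, forall w, h w = g a (past n w)}.

Definition shift_invariant (R : realType) (A : pointedType)
    (mu : probability (fullshift A) R) : Prop :=
  forall B : set (fullshift A), measurable B -> mu (@shiftZ A @^-1` B) = mu B.

Definition ergodic (R : realType) (A : pointedType)
    (mu : probability (fullshift A) R) : Prop :=
  shift_invariant mu /\
  forall B : set (fullshift A), measurable B -> @shiftZ A @^-1` B = B ->
    mu B = 0%E \/ mu B = 1%E.

(* Equality in the type [probability _ _] would also compare the junk values
   on non-measurable sets. *)
Definition distinct_probabilities d (T : measurableType d) (R : realType)
    (P Q : probability T R) : Prop :=
  exists2 B : set T, measurable B & P B <> Q B.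

Definition delta (R : realType) (A : Type) (n : nat)
    (f : ('I_n.+1 -> A) -> R) (j : 'I_n.+1) : \bar R :=
  ereal_sup [set v | exists (a b : A) (w : 'I_n.+1 -> A),
    v = `|f [eta w with j |-> a] - f [eta w with j |-> b]|%:E].

Definition in_L (R : realType) (A : Type) (n : nat)
    (f : ('I_n.+1 -> A) -> R) : Prop :=
  forall j, (delta f j < +oo)%E.

Definition delta_norm2 (R : realType) (A : Type) (n : nat)
    (f : ('I_n.+1 -> A) -> R) : R :=
  \sum_(j < n.+1) fine (delta f j) ^+ 2.

(* [f] viewed as a function of the coordinates 0, ..., n of a point of A^Z. *)
Definition on_coords (R : realType) (A : Type) (n : nat)
    (f : ('I_n.+1 -> A) -> R) (w : int -> A) : R :=
  f (fun i : 'I_n.+1 => w (i : nat)%:Z).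

Definition GCB (R : realType) (A : pointedType)
    (mu : probability (fullshift A) R) : Prop :=
  exists2 C : R, 0 < C & forall (n : nat) (f : ('I_n.+1 -> A) -> R), in_L f ->
    ('E_mu[fun w => expR (on_coords f w - fine 'E_mu[on_coords f])]
     <= (expR (C * delta_norm2 f))%:E)%E.

(* Main.v *)
Require Import Defs.
From HB Require Import structures.
From mathcomp Require Import all_boot all_order all_algebra.
From mathcomp Require Import finmap.
From mathcomp Require Import all_classical all_reals all_analysis.
From mathcomp Require Import zify ring lra.

(** Since g is bounded away from 0, the alphabet is finite. Let mu satisfy GCB
    and let nu be another shift-invariant measure, both compatible with g. The
    continuity of g makes the ratio nu[w]/mu[w] of the probabilities of words w
    of length n at most e^(o(n)), so the relative entropy density of nu with
    respect to mu is 0. Given a local set B, let S be the number of visits to B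
    along n disjoint blocks. GCB bounds E_mu[exp(t (S - n mu(B)))] by
    exp(C' t^2 n), hence the same expectation under nu by exp(C' t^2 n + o(n)),
    while by Jensen's inequality the latter is at least
    exp(t n (nu(B) - mu(B))). Letting n tend to infinity and choosing t small of
    the sign of nu(B) - mu(B) gives nu(B) = mu(B). So mu would be the only
    shift-invariant measure compatible with g. *)

Set Implicit Arguments.
Unset Strict Implicit.
Unset Printing Implicit Defensive.

Import Order.TTheory GRing.Theory Num.Theory.
Import numFieldNormedType.Exports.

Local Open Scope classical_set_scope.
Local Open Scope ring_scope.

(** * Consequences of positivity and continuity of the kernel *)

(** At a fixed past the masses [g a x] sum to 1 and each is at least [e], so more than [e^-1]
    letters cannot exist. *)
Lemma kernel_alphabet_finite (R : realType) (A : pointedType)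
    (g : A -> left_seq A -> R) (e : R) :
  is_prob_kernel g -> 0 < e -> (forall a x, e <= g a x) ->
  exists s : seq A, forall a, a \in s.
Proof.
move=> [_ g1] e0 eg.
have [/finite_seqP[s sE]|infA] := pselect (finite_set [set: A]).
  by exists s => a; have : [set: A] a by []; rewrite sE.
pose N := (Num.truncn e^-1).+1.
have [B BT NB] := infinite_set_fset N infA.
pose x : left_seq A := fun=> point.
have : (\sum_(a <- B) (g a x)%:E <= 1)%E.
  rewrite -(g1 x); apply: esum_ge; exists [set` B]; first by split.
  by rewrite fsbig_finite// set_fsetK.
rewrite sumEFin lee_fin => gB.
have : #|` B|%:R * e <= \sum_(a <- B) g a x.
  rewrite -sum1_size natr_sum mulr_suml ler_sum// => a _.
  by rewrite mul1r.
move=> /le_trans /(_ gB).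
have : e^-1 < #|` B|%:R.
  by rewrite (lt_le_trans (truncnS_gt _))// ler_nat.
by rewrite -[e^-1]div1r ltr_pdivrMr// => /lt_le_trans h /h; rewrite ltxx.
Qed.

Lemma kernel_uniform_continuity (R : realType) (A : pointedType)
    (g : A -> left_seq A -> R) (e : R) :
  kernel_var g j @[j --> \oo] --> 0%E -> 0 < e ->
  exists N : nat, forall n, (N <= n)%N -> forall a z z',
    (forall k, (k < n)%N -> z k = z' k) -> g a z <= g a z' + e.
Proof.
move=> gv e0.
(* The threshold [e / 2] matches the factor 1/2 of total variation: a single term of the sum is then
   at most [e]. *)
have : \forall j \near \oo, (kernel_var g j < (e / 2)%:E)%E.
  have e2 : 0 < e / 2 by rewrite divr_gt0.
  by have := gv _ (@nbhs_open_ereal_lt R 0 (fun=> e / 2) e2).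
move=> [N _ NP]; exists N => n Nn a z z' zz'.
have := NP n Nn => /= /ltW.
have : ((2^-1)%:E * `|g a z - g a z'|%:E <= kernel_var g n)%E.
  apply: (@le_trans _ _ ((2^-1)%:E * \esum_(b in [set: A]) `|g b z - g b z'|%:E)%E).
    rewrite lee_pmul2l// ?lte_fin//.
    apply: esum_ge; exists [set a]; first by split.
    by rewrite fsbig_set1.
  by apply: ereal_sup_ubound; exists z, z'.
move=> /le_trans h /h; rewrite -EFinM lee_fin mulrC ler_pM2r//.
by rewrite ler_norml => /andP[_]; rewrite lerBlDl addrC.
Qed.

(** * Word probabilities and the growth of their ratio *)

Definition word_set (A : Type) (n : nat) (c : nat -> A) : set (int -> A) :=
  [set w | forall k : nat, (k < n)%N -> w k%:Z = c k].

Lemma word_set0 (A : Type) (c : nat -> A) : word_set 0 c = setT.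
Proof. by apply/seteqP; split. Qed.

Lemma word_setS (A : Type) n (c : nat -> A) :
  word_set n.+1 c = [set w | w n%:Z = c n] `&` word_set n c.
Proof.
apply/seteqP; split => w /= => [wc|[wn wc] k].
  by split; [exact: wc|move=> k kn; apply: wc; exact: ltnW].
by rewrite ltnS leq_eqVlt => /predU1P[->//|]; exact: wc.
Qed.

Lemma measurable_coord (A : pointedType) (i : int) (a : A) :
  measurable ([set w | w i = a] : set (fullshift A)).
Proof.
apply: sub_sigma_algebra; exists i, i, (fun=> a).
apply/seteqP; split => w /= => [wi k|]; last by apply; rewrite lexx.
by rewrite -eq_le => /eqP <-.
Qed.

Lemma measurable_word_set (A : pointedType) n (c : nat -> A) :
  measurable (word_set n c : set (fullshift A)).
Proof.
elim: n => [|n ih]; first by rewrite word_set0.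
by rewrite word_setS; apply: measurableI => //; exact: measurable_coord.
Qed.

Lemma past_word_set (A : pointedType) n (c : nat -> A) :
  past_sigma_algebra n%:Z (word_set n c).
Proof.
rewrite /past_sigma_algebra; set G := (X in <<s X >>).
suff H m : (m <= n)%N -> <<s G >> (word_set m c) by exact: H.
elim: m => [_|m ih mn].
  by rewrite word_set0; exact: (@measurableT _ (g_sigma_algebraType G)).
rewrite word_setS; apply: (@measurableI _ (g_sigma_algebraType G)).
  apply: sub_sigma_algebra; exists m%:Z, [set c m]; split => //.
  by rewrite lerBrDr; lia.
by apply: ih; exact: ltnW.
Qed.

(** The integral of [h] over [B] is [P (E]&[B)]. Removing the null set [N] off which [h] equals [f]
    lets the pointwise bounds on [f] be integrated without asking [f] to be measurable. *)
Lemma cond_prob_version_bounds d (T : measurableType d) (R : realType)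
    (P : probability T R) (G : set (set T)) (E B : set T) (h f : T -> R)
    (l u : R) :
  cond_prob_version P G E h -> {ae P, forall w, h w = f w} ->
  G B -> measurable B -> (forall w, B w -> l <= f w <= u) ->
  (l%:E * P B <= P (E `&` B) <= u%:E * P B)%E.
Proof.
move=> [_ ih hB] [N [mN PN0 hN]] GB mB lfu.
have iB : P.-integrable B (EFin \o h) by apply: integrableS ih.
have mD : measurable (B `\` N) by exact: measurableD.
have iD : P.-integrable (B `\` N) (EFin \o h).
  by apply: integrableS iB => //; exact: subDsetl.
have cD (r : R) : P.-integrable (B `\` N) (cst r%:E).
  exact: finite_measure_integrable_cst.
have PD : P (B `\` N) = P B.
  rewrite measureD//; last by rewrite ltey_eq fin_num_measure.
  rewrite (@subset_measure0 _ _ _ P (B `&` N) N) ?sube0//.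
  exact: measurableI.
rewrite -hB// (negligible_integral mN mB iB PN0) -PD -!integral_cst//.
have hf w : (B `\` N) w -> h w = f w.
  by move=> [_ /(contra_not (hN w))] /contrapT.
apply/andP; split; apply: le_integral => // w /set_mem Dw;
  by rewrite /= lee_fin hf//; have /andP[] := lfu w Dw.1.
Qed.

Definition word_prob (R : realType) (A : pointedType)
    (mu : probability (fullshift A) R) n (c : nat -> A) : R :=
  fine (mu (word_set n c)).

Lemma word_prob_ge0 (R : realType) (A : pointedType)
    (mu : probability (fullshift A) R) n c : 0 <= word_prob mu n c.
Proof. exact: fine_ge0. Qed.

(** The event [word_set n c] belongs to the past of time [n], and every past in it ends with the
    word [c] read backwards; the bounds on [g] over such pasts therefore pass to the conditional
    probability of the next letter. *)
Lemma word_prob_step (R : realType) (A : pointedType)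
    (g : A -> left_seq A -> R) (mu : probability (fullshift A) R)
    n (c : nat -> A) (l u : R) :
  compatible g mu ->
  (forall z : left_seq A, (forall k, (k < n)%N -> z k = c (n - k.+1)%N) ->
    l <= g (c n) z <= u) ->
  l * word_prob mu n c <= word_prob mu n.+1 c <= u * word_prob mu n c.
Proof.
move=> /(_ n%:Z (c n))[h hv hg] lgu.
have mB := @measurable_word_set A n c.
have mB1 := @measurable_word_set A n.+1 c.
have B1 := word_setS n c.
have := cond_prob_version_bounds (l := l) (u := u) hv hg (@past_word_set A n c) mB.
rewrite -B1 -(fineK (fin_num_measure mu _ mB)) -(fineK (fin_num_measure mu _ mB1)).
rewrite -!EFinM !lee_fin; apply => w Bw; apply: lgu => k kn.
rewrite /past (_ : (n%:Z - k.+1%:Z)%R = (n - k.+1)%N%:Z); last by lia.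
by apply: Bw; lia.
Qed.

(* The conditional probabilities of the two measures at time [n] are averages
   of the same values of [g], whose oscillation tends to 0; hence the ratio of
   word probabilities grows subexponentially. *)
Lemma word_prob_subexponential_ratio (R : realType) (A : pointedType)
    (g : A -> left_seq A -> R) (e eta : R)
    (mu nu : probability (fullshift A) R) :
  is_prob_kernel g -> 0 < e -> (forall a x, e <= g a x) ->
  kernel_var g j @[j --> \oo] --> 0%E ->
  compatible g mu -> compatible g nu -> 0 < eta ->
  exists2 K : R, 0 < K &
    forall n c, word_prob nu n c <= K * (1 + eta) ^+ n * word_prob mu n c.
Proof.
move=> [g01 _] e0 eg gv cmu cnu eta0.
(* Chosen so that [x + d <= (1 + eta) * (x - d)] whenever [x >= e]. *)
pose d := eta * e / (2 + eta).
have eta2 : 0 < 2 + eta by lra.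
have d0 : 0 < d by rewrite divr_gt0 // mulr_gt0.
have dE : d * (2 + eta) = eta * e by rewrite divfK// gt_eqF.
have [N NP] := kernel_uniform_continuity gv d0.
have e1 : e <= 1.
  by apply: le_trans (eg point (fun=> point)) _; case/andP: (g01 point (fun=> point)).
have eV : 1 <= e^-1 by rewrite invf_ge1.
exists (e^-1 ^+ N); first by rewrite exprn_gt0 ?invr_gt0.
move=> n c.
(* The induction counts [minn n N] early steps, where only [e <= g <= 1] is known and a factor
   [e^-1] is lost; each later step costs only [1 + eta]. *)
suff H : word_prob nu n c <=
    e^-1 ^+ minn n N * (1 + eta) ^+ n * word_prob mu n c.
  apply: le_trans H _; apply: ler_wpM2r; first exact: word_prob_ge0.
  apply: ler_wpM2r; first by rewrite exprn_ge0//; lra.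
  by rewrite ler_weXn2l// geq_minr.
elim: n => [|n ih].
  by rewrite /word_prob !word_set0 !probability_setT min0n !expr0 !mul1r.
pose K := e^-1 ^+ minn n N * (1 + eta) ^+ n.
have K0 : 0 <= K by rewrite mulr_ge0// exprn_ge0 ?invr_ge0; lra.
have [nN|Nn] := ltnP n N.
  have lu (z : left_seq A) : (forall k, (k < n)%N -> z k = c (n - k.+1)%N) ->
      e <= g (c n) z <= 1.
    by move=> _; rewrite eg /=; case/andP: (g01 (c n) z).
  have /andP[_ h1] := word_prob_step cnu lu.
  have /andP[h2 _] := word_prob_step cmu lu.
  rewrite (minn_idPl nN) !exprS.
  rewrite mul1r in h1; apply: le_trans h1 (le_trans ih _); rewrite -/K.
  have -> : e^-1 * e^-1 ^+ n * ((1 + eta) * (1 + eta) ^+ n) =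
    K * (1 + eta) * e^-1 by rewrite /K (minn_idPl (ltnW nN)); ring.
  apply: (@le_trans _ _ (K * (1 + eta) * word_prob mu n c)).
    by rewrite ler_wpM2r ?word_prob_ge0//; apply: ler_peMr => //; lra.
  rewrite -[leRHS]mulrA; apply: ler_wpM2l; first by rewrite mulr_ge0//; lra.
  by rewrite ler_pdivlMl.
(* A reference past ending with the word; beyond the word, truncated subtraction makes it constantly
   [c 0]. *)
pose z0 : left_seq A := fun k => c (n - k.+1)%N.
have lu (z : left_seq A) : (forall k, (k < n)%N -> z k = c (n - k.+1)%N) ->
    g (c n) z0 - d <= g (c n) z <= g (c n) z0 + d.
  move=> zc; have zz0 k : (k < n)%N -> z k = z0 k by exact: zc.
  by rewrite (NP n)// lerBlDr (NP n)// => k /zz0.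
have /andP[_ h1] := word_prob_step cnu lu.
have /andP[h2 _] := word_prob_step cmu lu.
have Nn1 : (N <= n.+1)%N by exact: leqW.
move: ih; rewrite (minn_idPr Nn1) (minn_idPr Nn) exprS mulrCA => {K K0}.
set K := e^-1 ^+ N * (1 + eta) ^+ n => ih.
have K0 : 0 <= K by rewrite mulr_ge0// exprn_ge0 ?invr_ge0; lra.
have gE : g (c n) z0 + d <= (1 + eta) * (g (c n) z0 - d).
  have : eta * e <= eta * g (c n) z0 by rewrite ler_pM2l.
  by lra.
have gd0 : 0 <= g (c n) z0 + d by apply: addr_ge0; [apply: le_trans (ltW e0) _|exact: ltW].
apply: (le_trans h1); apply: (le_trans (ler_wpM2l gd0 ih)).
apply: (@le_trans _ _ (K * ((1 + eta) * (g (c n) z0 - d) * word_prob mu n c))).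
  rewrite mulrCA; apply: ler_wpM2l => //.
  by rewrite ler_wpM2r// word_prob_ge0.
rewrite -[leRHS]mulrA [leRHS]mulrCA.
by apply: ler_wpM2l => //; rewrite -mulrA ler_wpM2l//; lra.
Qed.

(** * Expectations of local functions as finite sums over words *)

Definition coords (A : Type) n (w : int -> A) : 'I_n -> A :=
  fun i => w (i : nat)%:Z.
Arguments coords {A} n w.

Definition extend_word (A : pointedType) n (v : 'I_n -> A) : nat -> A :=
  fun k => oapp v point (insub k).

Lemma word_set_extend (A : pointedType) n (v : 'I_n -> A) :
  word_set n (extend_word v) = [set w | coords n w = v].
Proof.
apply/seteqP; split => w /= => [wv|<- k kn].
  by apply/funext => i; rewrite /coords wv// /extend_word valK.
by rewrite /extend_word insubT.
Qed.

Section finite_alphabet.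
Variables (R : realType) (A : pointedType) (s : seq A).
Hypothesis s_full : forall a, a \in s.
Implicit Types mu : probability (fullshift A) R.

Let word n := {ffun 'I_n -> seq_sub s}.
Let letters n (u : word n) : 'I_n -> A := fun i => ssval (u i).

Let word_of n (v : 'I_n -> A) : word n := [ffun i => SeqSub (s_full (v i))].

Let word_ofK n (v : 'I_n -> A) : letters (word_of v) = v.
Proof. by apply/funext => i; rewrite /letters ffunE. Qed.

Let lettersK n (u : word n) : word_of (letters u) = u.
Proof. by apply/ffunP => i; rewrite ffunE; apply: val_inj. Qed.

(** The expectation of [F] of the first [n] coordinates, as a finite sum of reals; [integral_coords]
    identifies it with the integral. *)
Definition word_sum mu n (F : ('I_n -> A) -> R) : R :=
  \sum_(u : word n) F (letters u) * word_prob mu n (extend_word (letters u)).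

Lemma measurable_local n (Q : pred ('I_n -> A)) :
  measurable ([set w | Q (coords n w)] : set (fullshift A)).
Proof.
rewrite (_ : mkset _ = \bigcup_(u in [set u : word n | Q (letters u)])
    word_set n (extend_word (letters u))).
  apply: fin_bigcup_measurable => [|u _]; first exact: finite_finset.
  exact: measurable_word_set.
apply/seteqP; split => w /=.
  move=> Qw; exists (word_of (coords n w)) => /=; first by rewrite word_ofK.
  by rewrite word_set_extend /= word_ofK.
by move=> [u /= Qu]; rewrite word_set_extend /= => ->.
Qed.

(** The cylinders of the words of length [n] partition the space, so the integrand is a finite
    combination of their indicators. *)
Lemma integral_coords mu n (F : ('I_n -> A) -> R) :
  (\int[mu]_w (F (coords n w))%:E = (word_sum mu F)%:E)%E.
Proof.
pose B (u : word n) : set (fullshift A) := word_set n (extend_word (letters u)).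
have mB u : measurable (B u) by exact: measurable_word_set.
have FE w : F (coords n w) = \sum_(u : word n) F (letters u) * \1_(B u) w.
  rewrite (bigD1 (word_of (coords n w)))//= word_ofK big1 ?addr0.
    by rewrite indicE mem_set ?mulr1// /B word_set_extend /= word_ofK.
  move=> u uw; rewrite indicE memNset ?mulr0//.
  by rewrite /B word_set_extend /= => wu; rewrite wu lettersK eqxx in uw.
under eq_integral do rewrite FE -sumEFin.
rewrite integral_sum//; last first.
  move=> u; have iB : mu.-integrable setT (EFin \o \1_(B u)).
    exact: integrable_indic.
  by have := integrableZl measurableT (F (letters u)) iB.
rewrite /word_sum -sumEFin; apply: eq_bigr => u _.
under eq_integral do rewrite EFinM.
rewrite integralZl//; last exact: integrable_indic.
by rewrite integral_indic// setIT EFinM (fineK (fin_num_measure mu _ (mB u))).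
Qed.

Lemma word_sum_local mu n (Q : pred ('I_n -> A)) :
  word_sum mu (fun v => (Q v)%:R) = fine (mu [set w | Q (coords n w)]).
Proof.
apply: EFin_inj; rewrite -integral_coords fineK; last first.
  by rewrite fin_num_measure//; exact: measurable_local.
have mQ := measurable_local Q.
rewrite -[X in _ = mu X]setIT -integral_indic//; apply: eq_integral => w _.
by rewrite indicE; congr (_%:R)%:E; congr nat_of_bool; apply/idP/idP; rewrite inE.
Qed.

Lemma word_sum_cst mu n (r : R) : word_sum mu (fun _ : 'I_n -> A => r) = r.
Proof.
apply: EFin_inj; rewrite -integral_coords integral_cst//.
by have /= -> := probability_setT mu; rewrite mule1.
Qed.

Lemma word_sumD mu n (F G : ('I_n -> A) -> R) :
  word_sum mu (fun v => F v + G v) = word_sum mu F + word_sum mu G.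
Proof. by rewrite -big_split; apply: eq_bigr => u _; rewrite mulrDl. Qed.

Lemma word_sumZ mu n (r : R) (F : ('I_n -> A) -> R) :
  word_sum mu (fun v => r * F v) = r * word_sum mu F.
Proof. by rewrite mulr_sumr; apply: eq_bigr => u _; rewrite mulrA. Qed.

Lemma word_sum_sum mu n k (F : 'I_k -> ('I_n -> A) -> R) :
  word_sum mu (fun v => \sum_(i < k) F i v) = \sum_(i < k) word_sum mu (F i).
Proof.
by rewrite exchange_big; apply: eq_bigr => u _; rewrite mulr_suml.
Qed.

Lemma le_word_sum mu n (F G : ('I_n -> A) -> R) :
  (forall v, F v <= G v) -> word_sum mu F <= word_sum mu G.
Proof.
by move=> FG; apply: ler_sum => u _; rewrite ler_wpM2r// word_prob_ge0.
Qed.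

Lemma word_sum_ratio mu nu n (K : R) (F : ('I_n -> A) -> R) :
  (forall v, 0 <= F v) ->
  (forall c, word_prob nu n c <= K * word_prob mu n c) ->
  word_sum nu F <= K * word_sum mu F.
Proof.
move=> F0 numu; rewrite mulr_sumr; apply: ler_sum => u _.
by rewrite mulrCA ler_wpM2l.
Qed.

(** Jensen's inequality, obtained by averaging the tangent bound [1 + x <= expR x] at [x = F v - m],
    where [m] is the mean. *)
Lemma expR_word_sum mu n (F : ('I_n -> A) -> R) :
  expR (word_sum mu F) <= word_sum mu (expR \o F).
Proof.
set m := word_sum mu F.
have -> : word_sum mu (expR \o F) = expR m * word_sum mu (fun v => expR (F v - m)).
  rewrite -word_sumZ; apply: eq_bigr => u _.
  by rewrite -expRD addrCA subrr addr0.
rewrite ler_peMr ?expR_ge0//.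
have {1}<- : word_sum mu (fun v => 1 + (F v - m)) = 1.
  by rewrite !word_sumD !word_sum_cst -/m subrr addr0.
by apply: le_word_sum => v; rewrite expR_ge1Dx.
Qed.

End finite_alphabet.

(** * Translations, and invariant measures determined by one-sided words *)

Definition translate (A : Type) (k : int) (w : int -> A) : int -> A :=
  fun i => w (i + k).

Lemma measurable_translate (A : pointedType) k (B : set (fullshift A)) :
  measurable B -> measurable (@translate A k @^-1` B : set (fullshift A)).
Proof.
move=> mB.
suff mt : measurable_fun [set: fullshift A] (@translate A k : _ -> fullshift A).
  by rewrite -[_ @^-1` _]setTI; exact: mt.
apply: (@measurability _ _ (fullshift A) (fullshift A) setT _ (@cylinders A)) => //.
move=> _ [_ [i [j [c ->]]] <-].
rewrite setTI; apply: sub_sigma_algebra.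
exists (i + k), (j + k), (fun l => c (l - k)).
apply/seteqP; split => w wc l lij /=.
  by rewrite -wc /translate ?subrK// lerBrDr lerBlDr.
by rewrite /translate wc ?addrK// !lerD2r.
Qed.

Lemma shift_invariant_translate (R : realType) (A : pointedType)
    (mu : probability (fullshift A) R) k (B : set (fullshift A)) :
  shift_invariant mu -> measurable B -> mu (@translate A k @^-1` B) = mu B.
Proof.
move=> inv mB.
have pos (n : nat) (D : set (fullshift A)) : measurable D ->
    mu (@translate A n%:Z @^-1` D) = mu D.
  move=> mD; elim: n => [|n ih].
    congr (mu _); apply/seteqP; split => w; rewrite /preimage/= /translate.
      by under eq_fun do rewrite addr0.
    by move=> Dw; under eq_fun do rewrite addr0.
  rewrite -ih -[RHS]inv; last exact: measurable_translate.
  have tE w : translate n%:Z (shiftZ w) = translate n.+1%:Z w :> (int -> A).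
    by apply/funext => i; rewrite /translate /shiftZ; congr w; lia.
  by congr (mu _); apply/seteqP; split => w; rewrite /preimage/= tE.
case: k => n; first exact: pos.
rewrite -(pos n.+1); last exact: measurable_translate.
congr (mu _); apply/seteqP; split => w; rewrite /preimage/=;
  rewrite (_ : translate _ (translate _ w) = w)//;
  by apply/funext => i; rewrite /translate NegzE subrK ?addrK.
Qed.

(** Events depending on a finite window form a generating class stable under intersection, and
    translating the window to start at 0 does not change their measure. *)
Lemma shift_invariant_eq (R : realType) (A : pointedType)
    (s : seq A) (mu nu : probability (fullshift A) R) :
  (forall a, a \in s) -> shift_invariant mu -> shift_invariant nu ->
  (forall m (Q : pred ('I_m.+1 -> A)),
    mu [set w | Q (coords m.+1 w)] = nu [set w | Q (coords m.+1 w)]) ->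
  forall B : set (fullshift A), measurable B -> mu B = nu B.
Proof.
move=> s_full imu inu munu B mB.
pose local (k : nat) (D : set (int -> A)) := forall w w',
  (forall i : int, - k%:Z <= i <= k%:Z -> w i = w' i) -> D w -> D w'.
pose G : set (set (fullshift A)) := [set D | exists k, local k D].
have GE D : G D -> exists k m (Q : pred ('I_m.+1 -> A)),
    D = @translate A (- k) @^-1` [set w | Q (coords m.+1 w)].
  (* The window from [-k] to [k] has [(k + k).+1] coordinates; [r] rebuilds a sequence from them,
     with the value [point] outside. *)
  move=> [k Dk]; exists k%:Z, (k + k)%N.
  pose r (v : 'I_(k + k).+1 -> A) (i : int) := extend_word v `|(i + k%:Z)%R|%N.
  have rE w i : - k%:Z <= i <= k%:Z ->
      r (coords _ (translate (- k%:Z) w)) i = w i.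
    move=> ik; rewrite /r /extend_word insubT; first by lia.
    by move=> H; rewrite /= /coords /translate /=; congr w; lia.
  exists (fun v => `[< D (r v) >]); apply/seteqP; split => w /=.
    by move=> Dw; apply/asboolP; apply: Dk Dw => i /rE.
  by move=> /asboolP; apply: Dk => i /rE.
apply: (@g_sigma_algebra_measure_unique _ R (fullshift A) G _ (fun=> setT)).
- move=> D /GE[k [m [Q ->]]]; apply: measurable_translate.
  exact: (measurable_local s_full).
- by move=> _; exists 0%N.
- by rewrite bigcup_const.
- move=> D D' [k Dk] [k' Dk']; exists (maxn k k') => w w' ww' [Dw D'w]; split.
    by apply: Dk Dw => i ik; apply: ww'; lia.
  by apply: Dk' D'w => i ik; apply: ww'; lia.
- move=> D /GE[k [m [Q ->]]].
  have mQ := measurable_local s_full Q.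
  have muT := shift_invariant_translate (- k) imu mQ.
  have nuT := shift_invariant_translate (- k) inu mQ.
  exact: (etrans muT (etrans (munu m Q) (esym nuT))).
- by move=> _; apply: le_lt_trans (probability_le1 mu measurableT) _; rewrite ltry.
- apply: sub_smallest2r mB; first exact: smallest_sigma_algebra.
  move=> _ [i [j [c ->]]].
  exists (`|i| + `|j|)%N => w w' ww' wc l lij /=.
  by rewrite -wc// ww'//; lia.
Qed.

(** * Block sums: oscillations and means *)

(* Disjoint blocks: changing one coordinate of the word affects one term. *)
Definition block_sum (R : realType) (A : Type) m (Q : pred ('I_m.+1 -> A))
    (t : R) n (v : 'I_(n * m.+1).+1 -> A) : R :=
  t * \sum_(i < n) (Q (fun l => v (inord (i * m.+1 + l))))%:R.

Section block_sum.
Variables (R : realType) (A : pointedType) (m : nat).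
Variables (Q : pred ('I_m.+1 -> A)) (t : R).

Lemma delta_block_sum n j : (delta (@block_sum R A m Q t n) j <= `|t|%:E)%E.
Proof.
apply: ge_ereal_sup => _ [a [b [w ->]]].
rewrite lee_fin /block_sum -mulrBr -sumrB normrM ler_piMr//.
apply: le_trans (ler_norm_sum _ _ _) _.
(* The only block that can contain the coordinate [j]. *)
pose i0 := (j %/ m.+1)%N.
apply: (@le_trans _ _ (\sum_(i < n) ((i : nat) == i0)%:R)).
  apply: ler_sum => i _; case: eqVneq => [_|ii0].
    by case: (Q _); case: (Q _); rewrite ?subrr ?subr0 ?sub0r ?normrN ?normr0 ?normr1.
  set v := (X in `|(Q X)%:R - _|); set v' := (X in `|_ - (Q X)%:R|).
  suff -> : v = v' by rewrite subrr normr0.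
  apply/funext => l; rewrite /v /v' /=; case: eqP => // jE; move/eqP: ii0; case.
  rewrite /i0 -jE inordK; last first.
    by have := ltn_ord i; have := ltn_ord l; nia.
  by rewrite divnMDl// divn_small ?addn0.
rewrite -natr_sum (_ : 1 = 1%:R)// ler_nat.
(* The last coordinate [n * m.+1] lies in no block: there [i0 = n] and no term changes. *)
have [i0n|ni0] := ltnP i0 n.
  rewrite (bigD1 (Ordinal i0n))//= eqxx big1// => i ii0.
  by rewrite (_ : (_ == _) = false)//; apply: contra_neqF ii0 => /eqP ?; exact: val_inj.
rewrite big1// => i _; case: eqP => // ii0.
by move: ni0; rewrite -ii0 leqNgt ltn_ord.
Qed.

Lemma delta_block_sum_ge0 n j : (0 <= delta (@block_sum R A m Q t n) j)%E.
Proof.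
apply: ereal_sup_ubound; exists point, point, (fun=> point).
by rewrite subrr normr0.
Qed.

Lemma in_L_block_sum n : in_L (@block_sum R A m Q t n).
Proof. by move=> j; apply: le_lt_trans (delta_block_sum j) _; rewrite ltry. Qed.

Lemma delta_norm2_block_sum n :
  delta_norm2 (@block_sum R A m Q t n) <= t ^+ 2 *+ (n * m.+1).+1.
Proof.
rewrite -[X in _ *+ X]card_ord -sumr_const; apply: ler_sum => j _.
have := delta_block_sum j; have := delta_block_sum_ge0 j.
rewrite -(real_normK (num_real t)).
case: (delta _ j) => //= r; rewrite !lee_fin => r0 rt.
by rewrite ler_sqr ?nnegrE.
Qed.

End block_sum.

(** By linearity and invariance, since each block is a translate of the first one. *)
Lemma word_sum_block_sum (R : realType) (A : pointedType) (s : seq A)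
    (s_full : forall a, a \in s) (mu : probability (fullshift A) R)
    m (Q : pred ('I_m.+1 -> A)) (t : R) n :
  shift_invariant mu ->
  word_sum s mu (@block_sum R A m Q t n) =
  t * n%:R * fine (mu [set w | Q (coords m.+1 w)]).
Proof.
move=> imu; rewrite /block_sum word_sumZ -mulrA; congr (_ * _).
rewrite word_sum_sum mulr_natl -[X in _ *+ X]card_ord -sumr_const.
apply: eq_bigr => i _; rewrite word_sum_local//.
have mQ := measurable_local s_full Q.
have muT := shift_invariant_translate (i * m.+1)%N%:Z imu mQ.
rewrite -[RHS](congr1 fine muT); congr (fine (mu _)); apply/seteqP; split => w /=;
  rewrite (_ : (fun l => _) = coords m.+1 (translate (i * m.+1)%N%:Z w))//;
  apply/funext => l; rewrite /coords inordK /translate; try (congr w; lia);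
  have := ltn_ord i; have := ltn_ord l; nia.
Qed.

(** * Concentration against subexponential ratios, and the conclusion *)

Lemma GCB_word_sum (R : realType) (A : pointedType) (s : seq A)
    (s_full : forall a, a \in s) (mu : probability (fullshift A) R) :
  GCB mu -> exists2 C : R, 0 < C &
    forall n (f : ('I_n.+1 -> A) -> R), in_L f ->
    word_sum s mu (fun v => expR (f v - word_sum s mu f)) <= expR (C * delta_norm2 f).
Proof.
move=> [C C0 H]; exists C => // n f fL; have := H n f fL.
by rewrite unlock (integral_coords s_full mu f) /=
  (integral_coords s_full mu (fun v => expR (f v - word_sum s mu f))) lee_fin.
Qed.

Lemma expR_linear_unbounded (R : realType) (r K : R) :
  0 < r -> ~ (forall n, expR (r *+ n) <= K).
Proof.
move=> r0 H.
have := H (Num.truncn (K / r)).+1; rewrite leNgt => /negP; apply.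
apply: lt_le_trans (expR_ge1Dx _).
have : K / r < (Num.truncn (K / r)).+1%:R by exact: truncnS_gt.
by rewrite ltr_pdivrMr// -mulr_natl mulrC; lra.
Qed.

(* [nu] sees the exponential moment controlled by the concentration of [mu] up
   to the factor [K]; Jensen's inequality bounds that moment from below. *)
Lemma GCB_block_deviation (R : realType) (A : pointedType) (s : seq A)
    (s_full : forall a, a \in s) (mu nu : probability (fullshift A) R)
    m (Q : pred ('I_m.+1 -> A)) (C K t : R) n :
  (forall n (f : ('I_n.+1 -> A) -> R), in_L f ->
    word_sum s mu (fun v => expR (f v - word_sum s mu f))
      <= expR (C * delta_norm2 f)) -> 0 <= C ->
  shift_invariant mu -> shift_invariant nu -> 0 <= K ->
  (forall c, word_prob nu (n * m.+1).+1 c <= K * word_prob mu (n * m.+1).+1 c) ->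
  expR (t * n%:R * (fine (nu [set w | Q (coords m.+1 w)]) -
                    fine (mu [set w | Q (coords m.+1 w)])))
    <= K * expR (C * (t ^+ 2 *+ (n * m.+1).+1)).
Proof.
move=> gcb C0 imu inu K0 numu.
pose f := @block_sum R A m Q t n.
apply: (@le_trans _ _ (word_sum s nu (expR \o (fun v => f v - word_sum s mu f)))).
  apply: le_trans (expR_word_sum s_full nu _).
  by rewrite word_sumD (word_sum_cst s_full) !word_sum_block_sum// ler_expR mulrBr.
have F0 v : 0 <= (expR \o (fun v => f v - word_sum s mu f)) v by exact: expR_ge0.
apply: (le_trans (word_sum_ratio s F0 numu)).
apply: ler_wpM2l => //; apply: (le_trans (gcb _ f (@in_L_block_sum _ _ _ Q t n))).
by rewrite ler_expR ler_wpM2l// delta_norm2_block_sum.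
Qed.

Lemma GCB_rigidity (R : realType) (A : pointedType)
    (g : A -> left_seq A -> R) (e : R) (s : seq A)
    (mu nu : probability (fullshift A) R) :
  (forall a, a \in s) -> is_prob_kernel g ->
  0 < e -> (forall a x, e <= g a x) -> kernel_var g j @[j --> \oo] --> 0%E ->
  shift_invariant mu -> shift_invariant nu ->
  compatible g mu -> compatible g nu -> GCB mu ->
  forall B : set (fullshift A), measurable B -> mu B = nu B.
Proof.
move=> s_full g1 e0 eg gv imu inu cmu cnu /(GCB_word_sum s_full)[C C0 gcb].
apply: (shift_invariant_eq s_full imu inu) => m Q.
have mQ := measurable_local s_full Q.
pose b := fine (mu [set w | Q (coords m.+1 w)]).
pose b' := fine (nu [set w | Q (coords m.+1 w)]).
suff /eqP bb' : b' - b == 0.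
  rewrite -[LHS](fineK (fin_num_measure mu _ mQ)).
  rewrite -[RHS](fineK (fin_num_measure nu _ mQ)).
  by congr EFin; apply/esym/eqP; rewrite -subr_eq0 bb'.
apply/negP => /negP bb'.
pose M : R := m.+1%:R.
have M0 : 0 < M by rewrite ltr0n.
have CM0 : 0 < C * M by rewrite mulr_gt0.
(* The maximizer of [t * (b' - b) - C * M * t ^+ 2], the gain minus the concentration cost per
   block; the gain is [2 * r], the cost [r]. *)
pose t := (b' - b) / (2 * (C * M)).
pose r := C * t ^+ 2 * M.
have r0 : 0 < r.
  by rewrite /r mulrAC mulr_gt0// exprn_even_gt0//= mulf_neq0 ?invr_neq0//; lra.
have tr : t * (b' - b) = 2 * r.
  by rewrite /r /t; field; rewrite !gt_eqF.
(* With this [eta] the ratio of word probabilities costs only [r / 2] per block, which leaves a net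
   exponent [r / 2]. *)
pose eta := expR (r / (2 * M)) - 1.
have eta0 : 0 < eta by rewrite subr_gt0 expR_gt1 divr_gt0// mulr_gt0.
have [K K0 KP] := word_prob_subexponential_ratio g1 e0 eg gv cmu cnu eta0.
have r20 : 0 < r / 2 by rewrite divr_gt0.
(* The two exponential constants come from the one coordinate beyond the [n] blocks. *)
apply: (expR_linear_unbounded (K := K * expR (r / (2 * M)) * expR (C * t ^+ 2)) r20) => n.
have K1 : 0 <= K * (1 + eta) ^+ (n * m.+1).+1.
  by rewrite mulr_ge0 ?exprn_ge0 ?(ltW K0)//; lra.
have := GCB_block_deviation s_full Q t gcb (ltW C0) imu inu K1 (KP _).
rewrite -/b -/b' mulrAC tr [1 + eta](_ : _ = expR (r / (2 * M))); last first.
  by rewrite /eta addrC subrK.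
rewrite -expRM_natl => H.
(* Both sides are multiplied by the total cost of the [n] blocks, [r + r / 2] each. *)
rewrite -(ler_pM2r (expR_gt0 (r * (3 / 2) * n%:R))) -expRD.
rewrite (_ : r / 2 *+ n + r * (3 / 2) * n%:R = 2 * r * n%:R); last first.
  by rewrite -mulr_natr; field.
have rE : r = C * t ^+ 2 * M by [].
have nE : (n * m.+1).+1%:R = n%:R * M + 1 by rewrite -addn1 natrD natrM.
move: H; rewrite -[(t ^+ 2 *+ _)%R]mulr_natr nE; clearbody t r M => /le_trans; apply.
rewrite le_eqVlt -!mulrA -!expRD; apply/orP; left; apply/eqP.
by congr (_ * expR _); rewrite rE; field; rewrite gt_eqF.
Qed.

Theorem theorem3p5 (R : realType) (A : pointedType)
    (A_countable : countable [set: A])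
    (g : A -> left_seq A -> R)
    (g_kernel : is_prob_kernel g)
    (g_inf : 0 < inf [set r | exists (a : A) (x : left_seq A), r = g a x])
    (g_var : kernel_var g j @[j --> \oo] --> 0%E)
    (g_two_ergodic : exists mu1 mu2 : probability (fullshift A) R,
       [/\ ergodic mu1 /\ compatible g mu1,
           ergodic mu2 /\ compatible g mu2 &
           distinct_probabilities mu1 mu2])
    (mu : probability (fullshift A) R)
    (mu_ergodic : ergodic mu) (mu_compatible : compatible g mu) :
  ~ GCB mu.
Proof.
set I := mkset _ in g_inf.
have e_le a x : inf I <= g a x.
  apply: ge_inf; last by exists a, x.
  by exists 0 => _ [b [y ->]]; case/andP: (g_kernel.1 b y).
have [s s_full] := kernel_alphabet_finite g_kernel g_inf e_le.
case: g_two_ergodic => mu1 [mu2 [[erg1 c1] [erg2 c2] [B mB]]] mu12 gcb.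
(* Since [mu] may differ from both [mu1] and [mu2], rigidity is applied to each: both agree with
   [mu] on [B], hence with each other. *)
have eqmu := GCB_rigidity s_full g_kernel g_inf e_le g_var mu_ergodic.1 _
  mu_compatible _ gcb mB.
by apply: mu12; rewrite -(eqmu mu1 erg1.1 c1) (eqmu mu2 erg2.1 c2).
Qed.
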